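(* Let $\varphi\in\mathcal{L}_\Diamond$. If $\varphi$ is not a theorem of $\mathcal{G}_\Diamond$, then there is a Gödel–Kripke model $M$ with finitely many worlds such that $\varphi$ is not valid in $M$.
   Context: $\mathcal{L}_\Diamond$ is the set of formulas built from a set $Var$ of propositional variables using $\wedge,\to,\bot,\Diamond$, with $\neg\varphi:=\varphi\to\bot$, $\varphi\vee\psi:=((\varphi\to\psi)\to\psi)\wedge((\psi\to\varphi)\to\varphi)$, $\varphi\leftrightarrow\psi:=(\varphi\to\psi)\wedge(\psi\to\varphi)$. The Gödel calculus $\mathcal{G}$ has axiom schemes $(\varphi\to\psi)\to((\psi\to\chi)\to(\varphi\to\chi))$; $(\varphi\wedge\psi)\to\varphi$; $(\varphi\wedge\psi)\to(\psi\wedge\varphi)$; $(\varphi\to(\psi\to\chi))\leftrightarrow((\varphi\wedge\psi)\to\chi)$; $\varphi\to(\varphi\wedge\varphi)$; $((\varphi\to\psi)\to\chi)\to(((\psi\to\varphi)\to\chi)\to\chi)$; $\bot\to\varphi$; and Modus Ponens. $\mathcal{G}_\Diamond$ adds the schemes $\Diamond(\varphi\vee\psi)\to(\Diamond\varphi\vee\Diamond\psi)$, $\Diamond\neg\neg\varphi\to\neg\neg\Diamond\varphi$, $\neg\Diamond\bot$, and the rule ''from $\varphi\to\psi$ infer $\Diamond\varphi\to\Diamond\psi$''. Semantics: on $[0,1]$, $a\cdot b=\min\{a,b\}$, $a\Rightarrow b=1$ if $a\le b$ and $=b$ otherwise. A Gödel–Kripke model $\langle W,S,e\rangle$ has a nonempty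 set $W$, arbitrary $S:W\times W\to[0,1]$ and $e:W\times Var\to[0,1]$, extended by $e(x,\varphi\wedge\psi)=e(x,\varphi)\cdot e(x,\psi)$, $e(x,\varphi\to\psi)=e(x,\varphi)\Rightarrow e(x,\psi)$, $e(x,\bot)=0$, $e(x,\Diamond\varphi)=\sup_{y\in W}\{Sxy\cdot e(y,\varphi)\}$. A formula is valid in the model if $e(x,\varphi)=1$ for all $x\in W$. *)

(* Defs.v *)
From mathcomp Require Import all_boot all_order all_algebra.
From mathcomp Require Import all_classical all_reals.
Set Implicit Arguments.
Unset Strict Implicit.
Unset Printing Implicit Defensive.
Import Order.TTheory GRing.Theory Num.Theory.
Local Open Scope classical_set_scope.
Local Open Scope ring_scope.

Inductive formula (Var : Type) : Type :=
| FVar of Var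
| FBot
| FAnd of formula Var & formula Var
| FImp of formula Var & formula Var
| FDia of formula Var.

Arguments FBot {Var}.

Declare Scope formula_scope.
Delimit Scope formula_scope with F.
Bind Scope formula_scope with formula.

Definition FNot (Var : Type) (p : formula Var) : formula Var := FImp p FBot.

Notation "⊥" := FBot : formula_scope.
Notation "p ∧ q" := (FAnd p q) (at level 80, right associativity) : formula_scope.
Notation "p → q" := (FImp p q) (at level 99, right associativity) : formula_scope.
Notation "◇ p" := (FDia p) (at level 75, right associativity) : formula_scope.
Notation "¬ p" := (FNot p) (at level 75, right associativity) : formula_scope.

Definition FOr (Var : Type) (p q : formula Var) : formula Var :=
  (((p → q) → q) ∧ ((q → p) → p))%F.

Definition FIff (Var : Type) (p q : formula Var) : formula Var :=
  ((p → q) ∧ (q → p))%F.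

Notation "p ∨ q" := (FOr p q) (at level 85, right associativity) : formula_scope.
Notation "p ↔ q" := (FIff p q) (at level 95, no associativity) : formula_scope.

Inductive godel_axiom (Var : Type) : formula Var -> Prop :=
| GA_trans p q r : godel_axiom ((p → q) → ((q → r) → (p → r)))
| GA_andl p q : godel_axiom ((p ∧ q) → p)
| GA_andC p q : godel_axiom ((p ∧ q) → (q ∧ p))
| GA_curry p q r : godel_axiom ((p → (q → r)) ↔ ((p ∧ q) → r))
| GA_contr p : godel_axiom (p → (p ∧ p))
| GA_lin p q r : godel_axiom (((p → q) → r) → (((q → p) → r) → r))
| GA_bot p : godel_axiom (⊥ → p).

Inductive diamond_axiom (Var : Type) : formula Var -> Prop :=
| DA_or p q : diamond_axiom (◇ (p ∨ q) → (◇ p ∨ ◇ q))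
| DA_notnot p : diamond_axiom (◇ (¬ ¬ p) → ¬ ¬ ◇ p)
| DA_bot : diamond_axiom (¬ ◇ ⊥).

Inductive GDia_theorem (Var : Type) : formula Var -> Prop :=
| GDT_godel p : godel_axiom p -> GDia_theorem p
| GDT_diamond p : diamond_axiom p -> GDia_theorem p
| GDT_mp p q : GDia_theorem p -> GDia_theorem (p → q)%F -> GDia_theorem q
| GDT_mono p q : GDia_theorem (p → q)%F -> GDia_theorem (◇ p → ◇ q)%F.

Record GK_model (R : realType) (Var : Type) := GKModel {
  world : Type;
  world_inhabited : inhabited world;
  acc : world -> world -> R;
  val : world -> Var -> R;
  acc01 : forall x y, 0 <= acc x y <= 1;
  val01 : forall x v, 0 <= val x v <= 1
}.

Definition godel_imp (R : realType) (a b : R) : R := if a <= b then 1 else b.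

(* Every set whose [sup] is taken below is nonempty and included in [0, 1],
   hence [sup], the supremum in R, is also the supremum in [0, 1]. *)
Fixpoint eval (R : realType) (Var : Type) (M : GK_model R Var)
    (x : world M) (p : formula Var) {struct p} : R :=
  match p with
  | FVar v => val x v
  | FBot => 0
  | FAnd q r => Num.min (eval x q) (eval x r)
  | FImp q r => godel_imp (eval x q) (eval x r)
  | FDia q => sup (range (fun y : world M => Num.min (acc x y) (eval y q)))
  end.

Definition valid_in (R : realType) (Var : Type) (M : GK_model R Var)
    (p : formula Var) : Prop :=
  forall x : world M, eval x p = 1.

(* Main.v *)
(* Let F be the set of subformulas of phi, with bottom. The worlds are theories
   (sets of formulas containing the theorems and closed under modus ponens)
   whose provable implication is a total preorder on F; only finitely many pairs
   have to be compared, so the linearity axiom extends a theory missing chi to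
   such a theory without Zorn's lemma. The position of p in the preorder of P
   gives a value of p in [0, 1], equal to 1 iff p is in P and to 0 iff P refutes
   p. If P does not refute <>psi, there is a linear theory Q containing psi,
   refuting all p such that P refutes <>p, and missing all p with
   <>p < <>psi in P. Rescaling the values below 1 of Q under the nonzero values
   of P makes value_Q p <= value_P <>p for every p of the last kind, so an arrow
   from P to Q of weight value_P <>psi realizes <>psi without overshooting any
   other diamond. As phi has finite modal depth, bounded paths of such
   successors suffice, and they form a finite tree. *)

Require Import Defs.
From HB Require Import structures.
From mathcomp Require Import all_boot all_order all_algebra.
From mathcomp Require Import all_classical all_reals.
Local Open Scope classical_set_scope.

Set Implicit Arguments.
Unset Strict Implicit.
Unset Printing Implicit Defensive.

(** [Var] is an arbitrary type, so equality of formulas is decided classically. *)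
HB.instance Definition _ (Var : Type) := gen_eqMixin (formula Var).
HB.instance Definition _ (Var : Type) := gen_choiceMixin (formula Var).

(** * Theories and linearity on a finite list *)

(** Closure under the diamond rule is not asked: the deduction theorem would fail with it. *)
Definition is_theory (Var : Type) (G : formula Var -> Prop) :=
  (forall p, GDia_theorem p -> G p) /\
  (forall p q, G p -> G (p → q)%F -> G q).

Definition linear_on (Var : Type) (F : seq (formula Var))
    (G : formula Var -> Prop) :=
  {in F &, forall p q, G (p → q)%F \/ G (q → p)%F}.

Definition linear_theory (Var : Type) (F : seq (formula Var))
    (G : formula Var -> Prop) :=
  [/\ is_theory G, ~ G FBot & linear_on F G].

Definition big_or (Var : Type) (s : seq (formula Var)) : formula Var :=
  foldr (@FOr Var) FBot s.

(** * Theories of the calculus *)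

Section Theories.
Variable Var : Type.
Implicit Types (p q r x : formula Var) (G : formula Var -> Prop).

Lemma theorems_theory : is_theory (@GDia_theorem Var).
Proof. by split=> // p q; exact: GDT_mp. Qed.

Section Rules.
Variable G : formula Var -> Prop.
Hypothesis thG : is_theory G.

Lemma theory_thm p : GDia_theorem p -> G p.
Proof. exact: thG.1. Qed.

Lemma theory_mp p q : G (p → q)%F -> G p -> G q.
Proof. by move=> Gpq Gp; exact: thG.2 Gp Gpq. Qed.

Let ax p : godel_axiom p -> G p.
Proof. by move=> /(@GDT_godel Var); exact: theory_thm. Qed.

Lemma theory_trans p q r : G (p → q)%F -> G (q → r)%F -> G (p → r)%F.
Proof.
by move=> Gpq; apply: theory_mp; apply: theory_mp Gpq; apply/ax/GA_trans.
Qed.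

Lemma theory_andl p q : G (p ∧ q)%F -> G p.
Proof. by apply: theory_mp; apply/ax/GA_andl. Qed.

Lemma theory_andr p q : G (p ∧ q)%F -> G q.
Proof.
by move=> /(theory_mp (ax (GA_andC p q))); exact: theory_andl.
Qed.

Lemma theory_curry p q r : G ((p ∧ q) → r)%F -> G (p → q → r)%F.
Proof. by apply: theory_mp; apply: theory_andr; apply/ax/GA_curry. Qed.

Lemma theory_uncurry p q r : G (p → q → r)%F -> G ((p ∧ q) → r)%F.
Proof. by apply: theory_mp; apply: theory_andl; apply/ax/GA_curry. Qed.

Lemma theory_K p q : G p -> G (q → p)%F.
Proof. by apply: theory_mp; apply/theory_curry/ax/GA_andl. Qed.

Lemma theory_refl p : G (p → p)%F.
Proof. by apply: theory_trans (ax (GA_contr p)) _; apply/ax/GA_andl. Qed.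

Lemma theory_and p q : G p -> G q -> G (p ∧ q)%F.
Proof.
move=> Gp Gq; apply: theory_mp Gq; apply: theory_mp Gp.
exact/theory_curry/theory_refl.
Qed.

Lemma theory_S p q r : G (p → q → r)%F -> G (p → q)%F -> G (p → r)%F.
Proof.
move=> /theory_uncurry Gpqr Gpq.
have Gqpr : G (q → p → r)%F.
  by apply/theory_curry; apply: theory_trans Gpqr; apply/ax/GA_andC.
apply: theory_trans (ax (GA_contr p)) _.
exact/theory_uncurry/(theory_trans Gpq).
Qed.

Lemma theory_bot p : G FBot -> G p.
Proof. by apply: theory_mp; apply/ax/GA_bot. Qed.

Lemma theory_linear p q r :
  G ((p → q) → r)%F -> G ((q → p) → r)%F -> G r.
Proof.
by move=> G1; apply: theory_mp; apply: theory_mp G1; apply/ax/GA_lin.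
Qed.

Lemma theory_diamond p : diamond_axiom p -> G p.
Proof. by move=> /(@GDT_diamond Var); exact: theory_thm. Qed.

Lemma theory_mono p q : GDia_theorem (p → q)%F -> G (◇ p → ◇ q)%F.
Proof. by move/GDT_mono; exact: theory_thm. Qed.

End Rules.

(** * Deduction theorem and disjunction *)

Lemma theory_extend G p : is_theory G -> is_theory (fun x => G (p → x)%F).
Proof.
move=> thG; split=> [q /(theory_thm thG)|q r Gpq Gpqr]; first exact: theory_K.
exact: theory_S Gpqr Gpq.
Qed.

(** Quantifying over larger theories allows natural deduction with the rules above; the instance
    used is the set of [x] with [G (p → x)]. *)
Lemma theory_deduct G p q : is_theory G ->
  (forall G', is_theory G' -> (forall x, G x -> G' x) -> G' p -> G' q) ->
  G (p → q)%F.
Proof.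
move=> thG /(_ (fun x => G (p → x)%F)); apply; first exact: theory_extend.
- by move=> x; exact: theory_K.
- exact: theory_refl.
Qed.

Lemma theory_orl G p q : is_theory G -> G p -> G (p ∨ q)%F.
Proof.
move=> thG Gp; apply: theory_and => //; last exact: theory_K.
apply: theory_deduct => // G' thG' GG' G'pq.
exact: theory_mp G'pq (GG' _ Gp).
Qed.

Lemma theory_orr G p q : is_theory G -> G q -> G (p ∨ q)%F.
Proof.
move=> thG Gq; apply: theory_and => //; first exact: theory_K.
apply: theory_deduct => // G' thG' GG' G'qp.
exact: theory_mp G'qp (GG' _ Gq).
Qed.

(** Linearity splits on [p → q] and [q → p]; in each case one conjunct of [p ∨ q] yields a
    disjunct. *)
Lemma theory_or_elim G p q r : is_theory G ->
  G (p ∨ q)%F -> G (p → r)%F -> G (q → r)%F -> G r.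
Proof.
move=> thG Gpq Gpr Gqr; apply: (@theory_linear _ thG p q).
  apply: theory_deduct => // G' thG' GG' G'pq.
  apply: theory_mp (GG' _ Gqr) _ => //.
  by apply: theory_mp G'pq => //; apply: theory_andl (GG' _ Gpq).
apply: theory_deduct => // G' thG' GG' G'qp.
apply: theory_mp (GG' _ Gpr) _ => //.
by apply: theory_mp G'qp => //; apply: theory_andr (GG' _ Gpq).
Qed.

(** Linearity for [p] and [¬ p]: by contraction [p → ¬ p] gives [¬ p], hence [q], and [¬ p → p]
    gives [¬ ¬ p]. *)
Lemma not_imp_thm p q : GDia_theorem ((¬ p → q) → (¬ ¬ p ∨ q))%F.
Proof.
apply: (theory_deduct theorems_theory) => G thG _ Gpq.
apply: (@theory_linear _ thG p (¬ p)%F); apply: theory_deduct => // G' thG' GG' H.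
  apply: theory_orr => //; apply: theory_mp (GG' _ Gpq) _ => //.
  exact: theory_S H (theory_refl thG' p).
apply: theory_orl => //; exact: theory_S (theory_refl thG' _) H.
Qed.

Lemma theory_big_or G (s : seq (formula Var)) p :
  is_theory G -> p \in s -> G p -> G (big_or s).
Proof.
move=> thG + Gp; elim: s => //= q s IHs; rewrite in_cons => /predU1P[<-|/IHs].
  exact: theory_orl.
exact: theory_orr.
Qed.

(** * Extension to linear theories *)

(** If adjoining either implication of a pair produced [chi], the linearity axiom would already give
    [chi]. *)
Lemma extend_linear (s : seq (formula Var * formula Var)) G chi :
    is_theory G -> ~ G chi ->
  exists G', [/\ is_theory G', forall x, G x -> G' x, ~ G' chi &
    forall pq, pq \in s -> G' (pq.1 → pq.2)%F \/ G' (pq.2 → pq.1)%F].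
Proof.
move=> thG nGchi; elim: s => [|[p q] s [G1 [thG1 GG1 nG1chi linG1]]].
  by exists G.
have [a [a_pq nG1a]] : exists a, (a = (p → q)%F \/ a = (q → p)%F) /\
    ~ G1 (a → chi)%F.
  have [Gpq|?] := pselect (G1 ((p → q) → chi)%F); last first.
    by exists (p → q)%F; split; [left|].
  exists (q → p)%F; split; first by right.
  by move=> Gqp; apply/nG1chi/(theory_linear thG1 Gpq Gqp).
exists (fun x => G1 (a → x)%F); split=> //.
- exact: theory_extend.
- by move=> x /GG1; exact: theory_K.
- move=> pq /predU1P[->|/linG1[?|?]] /=; last 2 first.
  + by left; exact: theory_K.
  + by right; exact: theory_K.
  by case: a_pq => ->; [left|right]; exact: theory_refl.
Qed.

Lemma linear_theory_extend (F : seq (formula Var)) G chi :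
    is_theory G -> ~ G chi ->
  exists G', [/\ linear_theory F G', forall x, G x -> G' x & ~ G' chi].
Proof.
move=> thG nGchi.
have [G' [thG' GG' nG'chi linG']] :=
  extend_linear [seq (p, q) | p <- F, q <- F] thG nGchi.
exists G'; split=> //; split=> //; first by move/(theory_bot thG' chi).
by move=> p q pF qF; apply: (linG' (p, q)); apply: allpairs_f.
Qed.

(** * Diamonds in linear theories *)

Section LinearTheory.
Variables (F : seq (formula Var)) (G : formula Var -> Prop).
Hypotheses (linG : linear_theory F G) (botF : FBot \in F).
Let thG : is_theory G := let: And3 t _ _ := linG in t.
Let nG0 : ~ G FBot := let: And3 _ t _ := linG in t.
Let totG : linear_on F G := let: And3 _ _ t := linG in t.

(** Linearity is applied to [p] and [p → q]: [p → (p → q)] contracts to the missing [p → q], so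
    [(p → q) → p] holds. *)
Lemma linear_imp p q : p \in F -> (p → q)%F \in F ->
  ~ G (p → q)%F -> G ((p → q) → q)%F.
Proof.
move=> pF pqF nGpq; have [H|H] := totG pF pqF.
  by case: nGpq; exact: theory_S H (theory_refl thG p).
exact: theory_S (theory_refl thG _) H.
Qed.

(** [DA_or] splits the diamond and linearity picks the larger part, so [x] is a largest diamond;
    [FBot] serves the empty list by [DA_bot]. *)
Lemma linear_dia_big_or (s : seq (formula Var)) :
    {in s, forall p, (◇ p)%F \in F} ->
  exists2 x, x \in FBot :: [seq (◇ p)%F | p <- s] & G (◇ (big_or s) → x)%F.
Proof.
elim: s => [_|p s IHs sF].
  exists FBot; rewrite ?mem_head //.
  by apply: theory_diamond => //; exact: DA_bot.
have [|x xs Gx] := IHs; first by move=> q qs; apply: sF; rewrite in_cons qs orbT.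
have pF : (◇ p)%F \in F by apply: sF; rewrite mem_head.
have xF : x \in F.
  move: xs; rewrite in_cons => /predU1P[->//|/mapP[q qs ->]].
  by apply: sF; rewrite in_cons qs orbT.
have Gor : G (◇ (p ∨ big_or s) → ◇ p ∨ ◇ big_or s)%F.
  by apply: theory_diamond => //; exact: DA_or.
have key y : G (◇ p → y)%F -> G (x → y)%F -> G (◇ (p ∨ big_or s) → y)%F.
  move=> Gpy Gxy; apply: theory_trans Gor _ => //.
  apply: theory_deduct => // G' thG' GG' H.
  apply: theory_or_elim H _ _ => //; apply: GG' => //.
  exact: theory_trans Gx Gxy.
have [H|H] := totG pF xF.
  exists x; last exact: key H (theory_refl thG x).
  by move: xs; rewrite /= !in_cons => /predU1P[->|->]; rewrite ?eqxx ?orbT.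
exists (◇ p)%F; last exact: key (theory_refl thG _) H.
by rewrite /= !in_cons eqxx orbT.
Qed.

(* Q is the theory of a successor world that witnesses the value of <>psi. *)
Lemma linear_dia_witness psi : ~ G (¬ ◇ psi)%F -> exists Q,
  [/\ linear_theory F Q, Q psi,
      forall p, (◇ p)%F \in F -> G (¬ ◇ p)%F -> Q (¬ p)%F &
      forall p, (◇ p)%F \in F -> ~ G (◇ psi → ◇ p)%F -> ~ Q p].
Proof.
move=> nGpsi.
pose undia (f : formula Var) := if f is FDia p then [:: p] else [::].
pose D := flatten [seq undia f | f <- F].
have DP p : (p \in D) = ((◇ p)%F \in F).
  apply/flattenP/idP => [[_ /mapP[f fF ->]]|pF].
    by case: f fF => //= q qF; rewrite inE => /eqP ->.
  by exists [:: p]; rewrite ?mem_head //; apply/mapP; exists (◇ p)%F.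
(* [Q] must refute all of [zeros] and miss all of [below]; disjunctions turn this into one
   hypothesis [¬ delta] and one excluded formula [chi]. *)
pose zeros := [seq p <- D | `[< G (¬ ◇ p)%F >]].
pose below := [seq p <- D | `[< ~ G (◇ psi → ◇ p)%F >]].
pose delta := big_or zeros; pose chi := big_or below.
have Gdelta : G (¬ ◇ delta)%F.
  have [|x + Gx] := @linear_dia_big_or zeros.
    by move=> p; rewrite mem_filter DP => /andP[].
  rewrite in_cons => /predU1P[x0|/mapP[p pz xp]]; first by rewrite x0 in Gx.
  apply: theory_trans Gx _ => //; rewrite xp.
  by move: pz; rewrite mem_filter => /andP[/asboolP].
have nGchi : ~ G (◇ psi → ◇ chi)%F.
  move=> Gchi; have [|x + Gx] := @linear_dia_big_or below.
    by move=> p; rewrite mem_filter DP => /andP[].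
  have Gpx := theory_trans thG Gchi Gx.
  rewrite in_cons => /predU1P[x0|/mapP[p pz xp]]; first by rewrite x0 in Gpx.
  by move: pz; rewrite mem_filter => /andP[/asboolP + _]; apply; rewrite -xp.
(* Otherwise psi -> (not not delta \/ chi) is a theorem, and the axioms for the
   diamond turn it into <>psi -> (not not <>delta \/ <>chi), where <>delta is
   refuted by G. *)
have nTchi : ~ GDia_theorem (psi → ¬ delta → chi)%F.
  move=> Tchi; apply: nGchi.
  have Tor := theory_trans theorems_theory Tchi (not_imp_thm delta chi).
  have G1 : G (◇ psi → ◇ ¬ ¬ delta ∨ ◇ chi)%F.
    apply: theory_trans (theory_mono thG Tor) _ => //.
    by apply: theory_diamond => //; exact: DA_or.
  apply: theory_trans G1 _ => //; apply: theory_deduct => // G' thG' GG' H.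
  apply: theory_or_elim H _ (theory_refl thG' _) => //.
  apply: theory_deduct => // G2 thG2 G'G2 H; apply: theory_bot => //.
  have : G2 (¬ ◇ delta)%F by exact/G'G2/GG'.
  apply: theory_mp => //; apply: theory_mp H => //.
  by apply: theory_diamond => //; exact: DA_notnot.
(* Only theorems, not the members of [G], pass to the successor. *)
have thQ := theory_extend (¬ delta)%F (theory_extend psi theorems_theory).
have [Q [linQ subQ nQchi]] := linear_theory_extend F thQ nTchi.
have thQ' : is_theory Q by case: linQ.
exists Q; split=> // [|p pF Gp|p pF nGp Qp].
- apply: subQ; apply: theory_curry; first exact: theorems_theory.
  exact/GDT_godel/GA_andl.
- have Qdelta : Q (¬ delta)%F.
    apply: subQ; apply: theory_K; first exact: theorems_theory.
    by apply: theory_refl; exact: theorems_theory.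
  apply: theory_deduct => // G' thG' QG' G'p.
  apply: theory_mp (QG' _ Qdelta) _ => //.
  by apply: theory_big_or G'p => //; rewrite mem_filter DP pF andbT; apply/asboolP.
- apply: nQchi; apply: theory_big_or Qp => //.
  by rewrite mem_filter DP pF andbT; apply/asboolP.
Qed.

End LinearTheory.
End Theories.

(** * Subformulas and modal depth *)

Definition subformula_closed (Var : Type) (F : seq (formula Var)) :=
  [/\ FBot \in F,
      forall p q, (p ∧ q)%F \in F -> p \in F /\ q \in F,
      forall p q, (p → q)%F \in F -> p \in F /\ q \in F &
      forall p, (◇ p)%F \in F -> p \in F].

Fixpoint subformulas (Var : Type) (p : formula Var) : seq (formula Var) :=
  p :: match p with
       | FAnd q r | FImp q r => subformulas q ++ subformulas r
       | FDia q => subformulas q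
       | FVar _ | FBot => [::]
       end.

Lemma subformulas_refl (Var : Type) (p : formula Var) : p \in subformulas p.
Proof. by case: p => *; rewrite mem_head. Qed.

Lemma subformulas_trans (Var : Type) (p q : formula Var) :
  q \in subformulas p -> {subset subformulas q <= subformulas p}.
Proof.
elim: p => [v||p1 IH1 p2 IH2|p1 IH1 p2 IH2|p IH] /=;
  rewrite in_cons => /predU1P[-> //|]; rewrite ?mem_cat ?in_nil //.
- by move=> /orP[/IH1|/IH2] sub r /sub rp; rewrite in_cons mem_cat rp ?orbT.
- by move=> /orP[/IH1|/IH2] sub r /sub rp; rewrite in_cons mem_cat rp ?orbT.
- by move=> /IH sub r /sub rp; rewrite in_cons rp orbT.
Qed.

Lemma subformulas_closed (Var : Type) (p : formula Var) :
  subformula_closed (FBot :: subformulas p).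
Proof.
have sub (q r : formula Var) : q \in FBot :: subformulas p ->
    r \in subformulas q -> r \in FBot :: subformulas p.
  rewrite !in_cons => /predU1P[->|/subformulas_trans qp /qp ->];
    last by rewrite orbT.
  by rewrite inE => ->.
split; first exact: mem_head.
- by move=> q r /sub qrp; split; apply: qrp;
    rewrite /= in_cons mem_cat subformulas_refl !orbT.
- by move=> q r /sub qrp; split; apply: qrp;
    rewrite /= in_cons mem_cat subformulas_refl !orbT.
- by move=> q /sub; apply; rewrite /= in_cons subformulas_refl orbT.
Qed.

Fixpoint modal_depth (Var : Type) (p : formula Var) : nat :=
  match p with
  | FAnd q r | FImp q r => maxn (modal_depth q) (modal_depth r)
  | FDia q => (modal_depth q).+1
  | FVar _ | FBot => 0
  end.

(** * Real values and the path model *)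

Section Values.
Import Order.TTheory GRing.Theory Num.Theory.
Local Open Scope ring_scope.
Variables (R : realType) (Var : Type) (F : seq (formula Var)).
Hypothesis closedF : subformula_closed F.
Implicit Types (P Q : formula Var -> Prop) (p q : formula Var) (k : nat).

Let botF : FBot \in F. Proof. by case: closedF. Qed.

(** For [P] linear and [p] in [F], this counts the entries of [F] strictly below [p]. *)
Definition rank P p : nat := count (fun q => `[< ~ P (p → q)%F >]) F.

(* The scale shrinks with the level [k] so that a value below 1 at level [k.+1]
   is below every nonzero value at level [k]. *)
Definition value P k p : R :=
  if `[< P p >] then 1 else (rank P p)%:R / (size F).+1%:R ^+ k.+1.

Lemma scale_gt0 k : 0 < (size F).+1%:R ^+ k :> R.
Proof. by rewrite exprn_gt0 // ltr0Sn. Qed.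

Lemma value_in P k p : P p -> value P k p = 1.
Proof. by move=> Pp; rewrite /value asboolT. Qed.

Lemma value_notin P k p : ~ P p ->
  value P k p = (rank P p)%:R / (size F).+1%:R ^+ k.+1.
Proof. by move=> Pp; rewrite /value asboolF. Qed.

Lemma value_notin_bound P k p : ~ P p ->
  value P k p < ((size F).+1%:R ^+ k)^-1.
Proof.
move=> nPp; rewrite value_notin // exprS invfM mulrA.
rewrite ltr_pdivrMr ?scale_gt0 // mulVf ?gt_eqF ?scale_gt0 //.
by rewrite ltr_pdivrMr ?ltr0Sn // mul1r ltr_nat ltnS count_size.
Qed.

Lemma scale_le1 k : ((size F).+1%:R ^+ k)^-1 <= 1 :> R.
Proof. by rewrite invf_le1 ?scale_gt0 // exprn_ege1 // ler1n. Qed.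

Lemma value_lt1 P k p : ~ P p -> value P k p < 1.
Proof.
by move=> /(value_notin_bound k)/lt_le_trans; apply; exact: scale_le1.
Qed.

Lemma value01 P k p : 0 <= value P k p <= 1.
Proof.
have [Pp|nPp] := pselect (P p); first by rewrite value_in // ler01 lexx.
rewrite (ltW (value_lt1 k nPp)) andbT value_notin // divr_ge0 //.
exact/ltW/scale_gt0.
Qed.

(** * Values in a linear theory *)

Section FixedTheory.
Variable P : formula Var -> Prop.
Hypothesis linP : linear_theory F P.
Let thP : is_theory P. Proof. by case: linP. Qed.
Let nP0 : ~ P FBot. Proof. by case: linP. Qed.
Let totP : linear_on F P. Proof. by case: linP. Qed.

Lemma rank_le p q : P (p → q)%F -> (rank P p <= rank P q)%N.
Proof.
move=> Ppq; apply: sub_count => r /asboolP nPpr; apply/asboolP => Pqr.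
exact/nPpr/(theory_trans thP Ppq).
Qed.

(** Whatever is counted for [q] is counted for [p], and [q] itself is counted for [p] only. As [F]
    may repeat entries, [q] occurs at least once. *)
Lemma rank_lt p q : p \in F -> q \in F -> ~ P (p → q)%F ->
  (rank P q < rank P p)%N.
Proof.
move=> pF qF nPpq; have [//|Pqp] := totP pF qF.
set a := fun r => `[< ~ P (q → r)%F >].
have aq0 : count (predI a (pred1 q)) F = 0%N.
  rewrite (@eq_count _ _ pred0) ?count_pred0 // => r /=.
  apply/negP => /andP[/asboolP nPqr /eqP rq]; apply: nPqr.
  by rewrite rq; exact: theory_refl.
have q_gt0 : (0 < count (pred1 q) F)%N by rewrite -has_count has_pred1.
have aqE : (count (predU a (pred1 q)) F = count a F + count (pred1 q) F)%N.
  by rewrite -count_predUI aq0 addn0.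
apply: leq_trans (_ : _ <= count (predU a (pred1 q)) F)%N _.
  by rewrite aqE -[X in (X < _)%N]addn0 ltn_add2l.
apply: sub_count => r /orP[/asboolP nPqr|/eqP ->]; apply/asboolP => //.
by move=> Ppr; exact/nPqr/(theory_trans thP Pqp).
Qed.

Lemma value_le k p q : p \in F -> q \in F ->
  (value P k p <= value P k q) <-> P (p → q)%F.
Proof.
move=> pF qF; split=> [|Ppq].
  have [//|nPpq] := pselect (P (p → q)%F).
  rewrite leNgt => /negP; case.
  have nPq : ~ P q by move=> Pq; apply: nPpq; exact: theory_K.
  have [Pp|nPp] := pselect (P p).
    by rewrite (value_in k Pp) value_lt1.
  rewrite !value_notin // ltr_pM2r ?invr_gt0 ?scale_gt0 // ltr_nat.
  exact: rank_lt.
have [Pq|nPq] := pselect (P q).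
  by rewrite (value_in k Pq); case/andP: (value01 P k p).
have nPp : ~ P p by move=> /(theory_mp thP Ppq).
by rewrite !value_notin // ler_pM2r ?invr_gt0 ?scale_gt0 // ler_nat rank_le.
Qed.

Lemma value_bot k : value P k FBot = 0.
Proof.
rewrite value_notin // /rank (@eq_count _ _ pred0) ?count_pred0 ?mul0r //.
move=> q /=; apply/asboolP; apply; apply: theory_deduct => // G thG _.
exact: theory_bot.
Qed.

Lemma value_le0 k p : p \in F -> (value P k p <= 0) <-> P (¬ p)%F.
Proof. by move=> pF; rewrite -(value_bot k); exact: value_le. Qed.

(** A nonzero rank is at least 1; the resulting bound is the one that [value_notin_bound] gives from
    above at level [k.+1]. *)
Lemma value_gt0 k p : p \in F -> ~ P (¬ p)%F ->
  ((size F).+1%:R ^+ k.+1)^-1 <= value P k p.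
Proof.
move=> pF nPp; have [Pp|nP] := pselect (P p).
  by rewrite value_in // scale_le1.
rewrite value_notin // ler_peMl ?invr_ge0 ?(ltW (scale_gt0 _)) // ler1n.
by apply: leq_ltn_trans (rank_lt pF botF nPp).
Qed.

Lemma value_and k p q : (p ∧ q)%F \in F ->
  value P k (p ∧ q)%F = Num.min (value P k p) (value P k q).
Proof.
have [_ /(_ p q) cl _ _] := closedF.
move=> pqF; have [pF qF] := cl pqF.
have Pl : P ((p ∧ q) → p)%F.
  by apply: theory_deduct => // G thG _ /theory_andl; apply.
have Pr : P ((p ∧ q) → q)%F.
  by apply: theory_deduct => // G thG _ /theory_andr; apply.
apply/eqP; rewrite eq_le le_min; apply/andP; split.
  by apply/andP; split; apply/value_le.
rewrite ge_min; have [Ppq|Pqp] := totP pF qF; apply/orP; [left|right];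
  apply/value_le => //; apply: theory_deduct => // G thG GG Gx;
  by apply: theory_and => //; apply: theory_mp Gx => //; exact: GG.
Qed.

(** A missing [p → q] is equivalent to [q] in [P], by [linear_imp] and weakening. *)
Lemma value_imp k p q : (p → q)%F \in F ->
  value P k (p → q)%F = godel_imp (value P k p) (value P k q).
Proof.
have [_ _ /(_ p q) cl _] := closedF.
move=> pqF; have [pF qF] := cl pqF; rewrite /godel_imp.
case: ifPn => [/value_le Ppq|/negP nle]; first by rewrite value_in //; exact: Ppq.
have nPpq : ~ P (p → q)%F by move=> /(value_le k pF qF).
apply: le_anti; apply/andP; split; apply/value_le => //.
  exact (linear_imp linP pF pqF nPpq).
apply: theory_deduct => // G thG _; exact: theory_K.
Qed.

End FixedTheory.

(** Three cases: [◇ psi] is below [◇ p] and the weight suffices; [P] refutes [◇ p] and [p] has value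
    0 in [Q]; or [Q] misses [p], whose value falls under every nonzero value of level [k]. *)
Lemma value_dia_le P Q k psi p :
    linear_theory F P -> linear_theory F Q ->
    (forall q, (◇ q)%F \in F -> P (¬ ◇ q)%F -> Q (¬ q)%F) ->
    (forall q, (◇ q)%F \in F -> ~ P (◇ psi → ◇ q)%F -> ~ Q q) ->
    (◇ psi)%F \in F -> (◇ p)%F \in F ->
  Num.min (value P k (◇ psi)%F) (value Q k.+1 p) <= value P k (◇ p)%F.
Proof.
move=> linP linQ Q0 Qlt psiF pF; rewrite ge_min.
have [Ppp|nPpp] := pselect (P (◇ psi → ◇ p)%F).
  by apply/orP; left; apply/(value_le linP).
apply/orP; right; have [Pp|nPp] := pselect (P (¬ ◇ p)%F).
  have [_ _ _ /(_ _ pF) pF'] := closedF.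
  apply: (@le_trans _ _ 0); last by case/andP: (value01 P k (◇ p)%F).
  by apply/(value_le0 linQ k.+1 pF')/Q0.
apply/ltW/(lt_le_trans (value_notin_bound k.+1 (Qlt _ pF nPpp))).
exact: (value_gt0 linP).
Qed.


(** * The finite tree of paths *)

Section FiniteModel.
Variables (P0 : formula Var -> Prop)
  (step : (formula Var -> Prop) -> formula Var -> formula Var -> Prop).
Hypothesis linP0 : linear_theory F P0.
Hypothesis linear_step : forall P psi, linear_theory F P ->
  linear_theory F (step P psi).
Hypothesis step_witness : forall P psi, linear_theory F P ->
  ~ P (¬ ◇ psi)%F ->
  [/\ step P psi psi,
     forall q, (◇ q)%F \in F -> P (¬ ◇ q)%F -> step P psi (¬ q)%F &
     forall q, (◇ q)%F \in F -> ~ P (◇ psi → ◇ q)%F -> ~ step P psi q].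
Variable n : nat.

(* A world is a path of witness requests, most recent first. *)
Let request := seq_sub [seq p <- F | (◇ p)%F \in F].
Let path := n.-bseq request.
Implicit Types s t : path.

Definition path_theory (s : seq request) :=
  foldr (fun psi P => step P (val psi)) P0 s.

Definition path_value (s : seq request) p :=
  value (path_theory s) (size s) p.

(** A request whose diamond is refuted at [s] gets weight 0, so its lack of a witness is
    harmless. *)
Definition path_acc s t : R :=
  if val t is psi :: u then
    if u == val s then path_value s (◇ (val psi))%F else 0
  else 0.

Lemma path_acc01 s t : 0 <= path_acc s t <= 1.
Proof.
rewrite /path_acc; case: (val t) => [|psi u]; first by rewrite lexx ler01.
by case: ifP => _; [exact: value01 | rewrite lexx ler01].
Qed.

Definition path_model : GK_model R Var :=
  @GKModel R Var path (inhabits [bseq]) path_acc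
    (fun s v => path_value s (FVar v)) path_acc01
    (fun s v => value01 _ _ _).

Lemma path_linear s : linear_theory F (path_theory s).
Proof. by elim: (val s) => //= psi u IHu; exact: linear_step. Qed.

(** The truth lemma. The bound on depth plus length leaves room for one more request whenever [p] is
    a diamond. *)
Lemma eval_path p : p \in F -> forall s : world path_model,
  (modal_depth p + size (val s) <= n)%N -> eval s p = path_value s p.
Proof.
have [_ clA clI clD] := closedF.
elim: p => [v||p IHp q IHq|p IHp q IHq|p IHp] pF s //=.
- by rewrite /path_value value_bot //; exact: path_linear.
- have [pF' qF'] := clA _ _ pF.
  rewrite addn_maxl geq_max => /andP[ps qs]; rewrite IHp // IHq //.
  by rewrite /path_value value_and //; exact: path_linear.
- have [pF' qF'] := clI _ _ pF.
  rewrite addn_maxl geq_max => /andP[ps qs]; rewrite IHp // IHq //.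
  by rewrite /path_value value_imp //; exact: path_linear.
rewrite addSn => psn; have pF' := clD _ pF.
have linS := path_linear s.
have v0 : 0 <= path_value s (◇ p)%F.
  by case/andP: (value01 (path_theory s) (size (val s)) (◇ p)%F).
have le_value (t : path) :
    Num.min (path_acc s t) (eval (t : world path_model) p)
      <= path_value s (◇ p)%F.
  rewrite /path_acc; case tE: (val t) => [|psi u]; first by rewrite ge_min v0.
  case: eqP => [us|_]; last by rewrite ge_min v0.
  have psiF : (◇ (val psi))%F \in F.
    by have := valP psi; rewrite mem_filter => /andP[].
  rewrite IHp //; last by rewrite tE us /= addnS.
  have [Ppsi|nPpsi] := pselect (path_theory s (¬ ◇ (val psi))%F).
    rewrite ge_min; apply/orP; left; apply: le_trans v0.
    by apply/(value_le0 linS).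
  have [_ st0 stlt] := step_witness linS nPpsi.
  rewrite /path_value tE us /=; apply: value_dia_le => //.
  exact: linear_step.
apply/le_anti/andP; split.
  apply: ge_sup => [|_ [t _ <-] //].
  by exists (Num.min (path_acc s s) (eval s p)), s.
have pD : p \in [seq p <- F | (◇ p)%F \in F] by rewrite mem_filter pF pF'.
pose psi := SeqSub pD.
have sz : (size (psi :: val s) <= n)%N.
  by rewrite (leq_trans _ psn) //= ltnS leq_addl.
pose t : path := Bseq sz.
(* The supremum is attained at the path that requests [p]: there [p] has value 1, unless [◇ p] is
   refuted and both sides are 0. *)
have <- : Num.min (path_acc s t) (eval (t : world path_model) p) =
    path_value s (◇ p)%F.
  rewrite IHp //; last by rewrite /= addnS.
  rewrite /path_acc /= eqxx.
  have [Ppsi|nPpsi] := pselect (path_theory s (¬ ◇ p)%F).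
    have -> : path_value s (◇ p)%F = 0.
      by apply/le_anti; rewrite v0 andbT; apply/(value_le0 linS).
    apply/min_idPl.
    by case/andP: (value01 (path_theory t) (size (val t)) p).
  have [stp _ _] := step_witness linS nPpsi.
  rewrite /path_value (@value_in (path_theory t)) //.
  by apply/min_idPl; case/andP: (value01 (path_theory s) (size (val s)) (◇ p)%F).
apply: ub_le_sup; last by exists t.
by exists (path_value s (◇ p)%F) => _ [u _ <-].
Qed.

End FiniteModel.
End Values.

(** * The finite countermodel *)

Theorem theorem18 (R : realType) (Var : Type) (phi : formula Var) :
  ~ GDia_theorem phi ->
  exists M : GK_model R Var, finite_set [set: world M] /\ ~ valid_in M phi.
Proof.
move=> nphi; pose F := FBot :: subformulas phi.
have closedF : subformula_closed F := subformulas_closed phi.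
have botF : FBot \in F by case: closedF.
have [P0 [linP0 _ nP0phi]] := linear_theory_extend F (theorems_theory Var) nphi.
(* One successor is chosen for each theory and request; where no witness is due, the theory itself
   is the default. *)
have /choice[step stepP] (Ppsi : (formula Var -> Prop) * formula Var) :
    exists Q, linear_theory F Ppsi.1 -> linear_theory F Q /\
      (~ Ppsi.1 (¬ ◇ Ppsi.2)%F ->
       [/\ Q Ppsi.2,
        forall q, (◇ q)%F \in F -> Ppsi.1 (¬ ◇ q)%F -> Q (¬ q)%F &
        forall q, (◇ q)%F \in F -> ~ Ppsi.1 (◇ Ppsi.2 → ◇ q)%F -> ~ Q q]).
  case: Ppsi => P psi /=.
  have [[linP nP]|H] := pselect (linear_theory F P /\ ~ P (¬ ◇ psi)%F).
    have [Q [linQ Qpsi Q0 Qlt]] := linear_dia_witness linP botF nP.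
    by exists Q => _; split.
  by exists P => linP; split=> // nP; case: H.
pose M := path_model R F P0 (fun P psi => step (P, psi)) (modal_depth phi).
exists M; split; first exact: finite_finset.
have linstep P psi (linP : linear_theory F P) := stepP (P, psi) linP.
(* The empty path carries [P0], which misses [phi]; its length 0 makes [modal_depth phi] a
   sufficient bound. *)
move=> /(_ [bseq]); rewrite (eval_path closedF linP0); first 1 last.
- by move=> P psi /(linstep P psi)[].
- by move=> P psi /(linstep P psi)[].
- by rewrite in_cons subformulas_refl orbT.
- by rewrite addn0.
apply/eqP; rewrite Order.POrderTheory.lt_eqF //.
exact: value_lt1.
Qed.
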